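(* Let $S$ be the antipode of the Hopf algebra $\mathcal{H}^{\mathrm{dif}}$. For every $n\ge1$, $$S a_n=-a_n-\sum_{k=1}^{n-1}(-1)^k\sum_{\substack{n_1+\cdots+n_k+n_{k+1}=n\\ n_1,\dots,n_{k+1}>0}}\lambda(n_1,\dots,n_k)\,a_{n_1}\cdots a_{n_k}a_{n_{k+1}},$$ with coefficients $$\lambda(n_1,\dots,n_k)=\sum_{\substack{m_1+\dots+m_k=k\\ m_1+\dots+m_h\ge h,\ h=1,\dots,k-1}}\binom{n_1+1}{m_1}\cdots\binom{n_k+1}{m_k},$$ where the last sum runs over $k$-tuples $(m_1,\dots,m_k)$ of non-negative integers satisfying the indicated conditions.
   Context: $\mathcal{H}^{\mathrm{dif}}=\mathbb{C}\langle a_1,a_2,\dots\rangle$ is the free associative unital $\mathbb{C}$-algebra on infinitely many variables $a_n$, $n\ge 1$; put $a_0:=1$. Let $A(x)=\sum_{n\ge 0}a_n x^{n+1}$, where power series variables commute with everything. The co-product $\Delta^{\mathrm{dif}}:\mathcal{H}^{\mathrm{dif}}\to\mathcal{H}^{\mathrm{dif}}\otimes\mathcal{H}^{\mathrm{dif}}$ is the unital algebra homomorphism defined on generators by $$\Delta^{\mathrm{dif}}A(x):=\sum_{n\ge0}\Delta^{\mathrm{dif}}(a_n)x^{n+1}=\langle z^{-1}\rangle\, A(z)\otimes\frac{1}{z-A(x)},$$ where $\frac1{z-A(x)}$ is expanded as $\sum_{k\ge0}A(x)^k z^{-k-1}$ and $\langle z^{-1}\rangle F(z)$ denotes the coefficient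 of $z^{-1}$ in $F(z)$. The co-unit is the algebra homomorphism with $\varepsilon(a_n)=0$ for $n\ge1$. With these structures, and with $a_n$ of degree $n$, $\mathcal{H}^{\mathrm{dif}}$ is a graded connected Hopf algebra, so it has a unique antipode $S$. *)

(* Defs.v *)
From HB Require Import structures.
From mathcomp Require Import all_boot all_order all_algebra finmap.
From mathcomp Require Import classical_sets fsbigop reals.
From mathcomp Require Import complex monalg zify.

Set Implicit Arguments.
Unset Strict Implicit.
Unset Printing Implicit Defensive.

Import GRing.Theory.
Local Open Scope ring_scope.

Fact scale_aux (K : comNzRingType) (V : lmodType K) (c d : K) (a1 a2 b1 b2 : V) :
  d *: (c *: a1 + b1) + (c *: a2 + b2) = c *: (d *: a1 + a2) + (d *: b1 + b2).
Proof.
rewrite !scalerDr !scalerA (mulrC d) -!addrA; congr (_ + _).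
exact: addrCA.
Qed.

Section MonoidAlgebra.
Context (K : comNzRingType) (M : monomType).

Lemma malgZU (T : choiceType) (c : K) (m : T) :
  c *: << m >> = << c *g m >> :> {malg K[T]}.
Proof. by apply/malgP => k; rewrite mcoeffZ !mcoeffU mulr_natr. Qed.

Lemma malg_lin_ind (T : choiceType) (P : {malg K[T]} -> Prop) :
  (forall m, P << m >>) -> P 0 ->
  (forall c g1 g2, P g1 -> P g2 -> P (c *: g1 + g2)) -> forall g, P g.
Proof.
move=> PU P0 PD g; rewrite [g]monalgE.
elim: (enum_fset _) => [|m s IH]; first by rewrite big_nil.
by rewrite big_cons -malgZU; apply: PD.
Qed.

Lemma malg_lin_ext (T : choiceType) (V : lmodType K) (F G : {malg K[T]} -> V) :
  linear F -> linear G -> (forall m, F << m >> = G << m >>) -> F =1 G.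
Proof.
move=> linF linG FG; apply: malg_lin_ind => // [|c g1 g2 e1 e2].
- have lin0 (H : {malg K[T]} -> V) : linear H -> H 0 = 0.
    by move=> /(_ (-1) 0 0); rewrite scaler0 add0r scaleN1r addNr.
  by rewrite !lin0.
- by rewrite linF linG e1 e2.
Qed.

Lemma malgUM (m n : M) : << m >> * << n >> = << mmul m n >> :> {malg K[M]}.
Proof. by rewrite malgM_def fgmulUU mulr1. Qed.

Lemma malg_scalerAr (c : K) (u v : {malg K[M]}) : c *: (u * v) = u * (c *: v).
Proof.
move: u c; apply: malg_lin_ind => [m||d u1 u2 IH1 IH2] c; last 2 first.
- by rewrite !mul0r scaler0.
- by rewrite !mulrDl scalerDr -!scalerAl IH2 -IH1 !scalerA mulrC.
move: v c; apply: malg_lin_ind => [n||d v1 v2 IH1 IH2] c.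
- by rewrite malgUM !malgZU malgM_def fgmulUU mul1r.
- by rewrite !(mulr0, scaler0).
- by rewrite scalerDr !mulrDr scalerDr IH2 -IH1 !scalerA -IH1.
Qed.

Lemma malgMPl c (u1 u2 v : {malg K[M]}) :
  (c *: u1 + u2) * v = c *: (u1 * v) + u2 * v.
Proof. by rewrite mulrDl -scalerAl. Qed.

Lemma malgMPr c (u v1 v2 : {malg K[M]}) :
  u * (c *: v1 + v2) = c *: (u * v1) + u * v2.
Proof. by rewrite mulrDr -malg_scalerAr. Qed.

End MonoidAlgebra.

Section LinearExtension.
Context (K : comNzRingType) (M : choiceType) (V : lmodType K).

(* The linear map sending each basis element << m >> to f m. *)
Definition linext (f : M -> V) (g : {malg K[M]}) : V :=
  \sum_(m <- msupp g) g@_m *: f m.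

Lemma linextEw f (d : {fset M}) g : fsubset (msupp g) d ->
  linext f g = \sum_(m <- d) g@_m *: f m.
Proof.
move=> le; rewrite /linext (big_fset_incl _ le) // => m _ /mcoeff_outdom ->.
by rewrite scale0r.
Qed.

Lemma linextU f m : linext f << m >> = f m.
Proof.
by rewrite (linextEw _ msuppU_le) big_seq_fset1 mcoeffUU scale1r.
Qed.

Fact linext_is_linear f : linear (linext f).
Proof.
move=> c g1 g2; pose d := fsetU (msupp g1) (msupp g2).
have h1 : fsubset (msupp g1) d by apply: fsubsetUl.
have h2 : fsubset (msupp g2) d by apply: fsubsetUr.
have h : fsubset (msupp (c *: g1 + g2)) d.
  apply: fsubset_trans (msuppD_le _ _) _.
  by apply: fsetUSS => //; apply: msuppZ_le.
rewrite (linextEw f h) (linextEw f h1) (linextEw f h2) scaler_sumr -big_split.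
by apply: eq_bigr => m _ /=; rewrite mcoeffD mcoeffZ scalerDl scalerA.
Qed.

HB.instance Definition _ f :=
  GRing.isLinear.Build K {malg K[M]} V *:%R (linext f) (linext_is_linear f).

Lemma linextP f c g1 g2 : linext f (c *: g1 + g2) = c *: linext f g1 + linext f g2.
Proof. exact: linext_is_linear. Qed.

Lemma linext0 f : linext f 0 = 0.
Proof. exact: linear0. Qed.

End LinearExtension.

Section ProductMonoid.
Context (M N : monomType).

Definition prod_mone : (M * N)%type := (mone, mone).
Definition prod_mmul (p q : (M * N)%type) : (M * N)%type := (mmul p.1 q.1, mmul p.2 q.2).

Fact prod_mmulA : associative prod_mmul.
Proof. by move=> p q r; rewrite /prod_mmul /= !mulmA. Qed.
Fact prod_mmul1m : left_id prod_mone prod_mmul.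
Proof. by case=> p q; rewrite /prod_mmul /= !mul1m. Qed.
Fact prod_mmulm1 : right_id prod_mone prod_mmul.
Proof. by case=> p q; rewrite /prod_mmul /= !mulm1. Qed.
Fact prod_munitm p q :
  prod_mmul p q = prod_mone -> p = prod_mone /\ q = prod_mone.
Proof. by case: p q => [? ?] [? ?] [/unitm[-> ->] /unitm[-> ->]]. Qed.

HB.instance Definition _ := Choice_isMonomialDef.Build (M * N)%type
  prod_mmulA prod_mmul1m prod_mmulm1 prod_munitm.

End ProductMonoid.

(* The tensor product of the monoid algebras K[M] and K[N] is realised as the *)
(* monoid algebra K[M * N], the basis element << (m, n) >> standing for       *)
(* << m >> (x) << n >>; its product is the usual one on a tensor product of   *)
(* algebras (tensM).                                                          *)
Section Tensor.
Context (K : comNzRingType).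

Definition tens (M N : choiceType) (u : {malg K[M]}) (v : {malg K[N]}) :
    {malg K[(M * N)%type]} :=
  linext (fun m => linext (fun n => << (m, n) >>) v) u.

(* f (x) g *)
Definition tmap (M N M' N' : choiceType)
    (f : {malg K[M]} -> {malg K[M']}) (g : {malg K[N]} -> {malg K[N']}) :
    {malg K[(M * N)%type]} -> {malg K[(M' * N')%type]} :=
  linext (fun p => tens (f << p.1 >>) (g << p.2 >>)).

(* The multiplication of K[M], as a linear map on the tensor square. *)
Definition tmul (M : monomType) : {malg K[(M * M)%type]} -> {malg K[M]} :=
  linext (fun p => << mmul p.1 p.2 >>).

Section Theory.
Context (M N : choiceType).

Lemma tensU (m : M) (n : N) : tens << m >> << n >> = << (m, n) >>.
Proof. by rewrite /tens !linextU. Qed.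

Lemma tensPl c u1 u2 v : @tens M N (c *: u1 + u2) v = c *: tens u1 v + tens u2 v.
Proof. exact: linext_is_linear. Qed.

Lemma tens0l v : @tens M N 0 v = 0.
Proof. exact: linear0. Qed.

Lemma tens_is_linearr (u : {malg K[M]}) : linear (@tens M N u).
Proof.
move=> c v1 v2; move: u; apply: malg_lin_ind => [m||d u1 u2 IH1 IH2].
- by rewrite /tens !linextU linextP.
- by rewrite !tens0l scaler0 addr0.
- rewrite 3!tensPl IH1 IH2.
  exact: scale_aux.
Qed.

HB.instance Definition _ u := GRing.isLinear.Build K {malg K[N]}
  {malg K[(M * N)%type]} *:%R (@tens M N u) (tens_is_linearr u).

Lemma tensPr c u v1 v2 : @tens M N u (c *: v1 + v2) = c *: tens u v1 + tens u v2.
Proof. exact: tens_is_linearr. Qed.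

Lemma tens0r u : @tens M N u 0 = 0.
Proof. exact: linear0. Qed.

End Theory.

Lemma tmap_tens (M N M' N' : choiceType)
    (f : {linear {malg K[M]} -> {malg K[M']}})
    (g : {linear {malg K[N]} -> {malg K[N']}}) u v :
  tmap f g (tens u v) = tens (f u) (g v).
Proof.
move: u; apply: malg_lin_ext => [c u1 u2|c u1 u2|m].
- by rewrite tensPl /tmap linextP.
- by rewrite (linearP f c u1 u2) tensPl.
move: v; apply: malg_lin_ext => [c v1 v2|c v1 v2|n].
- by rewrite tensPr /tmap linextP.
- by rewrite (linearP g c v1 v2) tensPr.
by rewrite tensU /tmap linextU.
Qed.

Lemma tensM (M N : monomType) (u u' : {malg K[M]}) (v v' : {malg K[N]}) :
  tens u v * tens u' v' = tens (u * u') (v * v').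
Proof.
move: u; apply: malg_lin_ext => [c x y|c x y|m].
- by rewrite tensPl malgMPl.
- by rewrite malgMPl tensPl.
move: u'; apply: malg_lin_ext => [c x y|c x y|m'].
- by rewrite tensPl malgMPr.
- by rewrite malgMPr tensPl.
move: v; apply: malg_lin_ext => [c x y|c x y|n].
- by rewrite tensPr malgMPl.
- by rewrite malgMPl tensPr.
move: v'; apply: malg_lin_ext => [c x y|c x y|n'].
- by rewrite tensPr malgMPr.
- by rewrite malgMPr tensPr.
by rewrite !malgUM !tensU malgUM.
Qed.

Lemma tmul_tens (M : monomType) (u v : {malg K[M]}) : tmul (tens u v) = u * v.
Proof.
rewrite /tmul.
move: u; apply: malg_lin_ext => [c x y|c x y|m].
- by rewrite tensPl linextP.
- by rewrite malgMPl.
move: v; apply: malg_lin_ext => [c x y|c x y|n].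
- by rewrite tensPr linextP.
- by rewrite malgMPr.
by rewrite tensU linextU malgUM.
Qed.

End Tensor.

(* Formal power series, as sequences of coefficients. *)
Section PowerSeries.
Context (B : nzRingType).
Implicit Types f g : nat -> B.

Definition ser1 : nat -> B := fun n => (n == 0%N)%:R.
Definition sermul f g : nat -> B := fun n => \sum_(i < n.+1) f i * g (n - i)%N.
Definition serexp f (k : nat) : nat -> B := iter k (sermul f) ser1.

Lemma serexp_eq0 f k n : f 0%N = 0 -> (n < k)%N -> serexp f k n = 0.
Proof.
move=> f0; elim: k n => [//|k IH] n lt_nk.
rewrite /= /sermul big1 // => -[[|i] lt_in] _ /=; first by rewrite f0 mul0r.
by rewrite IH ?mulr0 //; move: lt_in lt_nk; case: n => // n;
  rewrite subSS !ltnS => _; apply: leq_ltn_trans (leq_subr _ _).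
Qed.

End PowerSeries.

(* The monoid algebra of the words in the letters 0, 1, 2, ...; the letter n  *)
(* is the generator a_(n+1).                                                  *)
Notation Hdif K := {malg K[{fmonom nat}]}.

Section HopfDif.
Context (K : comNzRingType).

Local Notation Hdif := (Hdif K).
Local Notation Hdif2 := {malg K[({fmonom nat} * {fmonom nat})%type]}.

Definition gen (n : nat) : Hdif := if n is n'.+1 then << fmu n' >> else 1.

(* A(x) = \sum_n a_n x^(n+1) *)
Definition Aser (i : nat) : Hdif := if i is n.+1 then gen n else 0.

(* The coefficient of z^i in A(z). *)
Definition Az (i : int) : Hdif := if i is Posz n then Aser n else 0.

(* The coefficient of z^j x^m in 1/(z - A(x)) = \sum_k A(x)^k z^(-k-1);       *)
(* recall that Negz k is -k-1.                                                *)
Definition resolvent (j : int) (m : nat) : Hdif :=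
  if j is Negz k then serexp Aser k m else 0.

(* The coefficient of z^p x^m in A(z) (x) 1/(z - A(x)); the sum is finitely   *)
(* supported because serexp Aser k m = 0 for m < k.                           *)
Definition Ares (p : int) (m : nat) : Hdif2 :=
  \sum_(ij \in [set ij : int * int | ij.1 + ij.2 = p]%classic)
    tens (Az ij.1) (resolvent ij.2 m).

(* The coefficient of x^(n+1) in <z^-1> A(z) (x) 1/(z - A(x)).                *)
Definition Delta_gen (n : nat) : Hdif2 := Ares (-1) n.+1.

(* The unital algebra morphism with Delta a_n = Delta_gen n (Delta_on_gen).   *)
Definition Delta : Hdif -> Hdif2 :=
  linext (fun w : {fmonom nat} => \prod_(i <- w) Delta_gen i.+1).

(* The coefficient of the empty word: the algebra morphism vanishing on every *)
(* a_n with n >= 1.                                                           *)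
Definition counit (h : Hdif) : K := h@_mone.

(* S is a two-sided convolution inverse of the identity.                      *)
Definition is_antipode (S : {linear Hdif -> Hdif}) : Prop :=
  (forall h, tmul (tmap S idfun (Delta h)) = (counit h)%:A) /\
  (forall h, tmul (tmap idfun S (Delta h)) = (counit h)%:A).

Lemma Delta_genE n :
  Delta_gen n = \sum_(m < n.+1) tens (gen m) (serexp Aser m.+1 n.+1).
Proof.
pose r := [seq (Posz m.+1, Negz m.+1) | m <- iota 0 n.+1].
rewrite /Delta_gen /Ares (fsbigE r); first last.
- move=> [i j] /= ij_1 ij_r; case: i j ij_1 ij_r => [[|m]|i] [j|k] //= ij_1 ij_r.
  + by rewrite tens0l.
  + have ek : k = m.+1 by move: ij_1; clear; lia.
    rewrite {}ek in ij_r *; rewrite [X in tens _ X]serexp_eq0 ?tens0r //.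
    rewrite ltnNge; apply: contra ij_r => le_mn; apply/mapP; exists m => //.
    by rewrite mem_iota.
  + by rewrite tens0l.
- by move=> _ /mapP[m _ ->] /=; lia.
- by rewrite map_inj_uniq ?iota_uniq // => m m' [].
rewrite big_mkcond big_map -{1}[n.+1]subn0 -/(index_iota 0 n.+1) big_mkord.
by apply: eq_bigr => m _; rewrite ifT // inE /=; lia.
Qed.

Lemma Delta_gen0 : Delta_gen 0 = 1.
Proof.
rewrite Delta_genE big_ord1 /= /sermul !big_ord_recl big_ord0 /= /ser1 /=.
by rewrite mul0r add0r addr0 mulr1 tensU.
Qed.

Fact Delta_is_linear : linear Delta.
Proof. exact: linext_is_linear. Qed.

HB.instance Definition _ :=
  GRing.isLinear.Build K Hdif Hdif2 *:%R Delta Delta_is_linear.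

Fact Delta_is_monoid_morphism : monoid_morphism Delta.
Proof.
rewrite /Delta; split=> [|u v]; first by rewrite linextU fm1 big_nil.
move: u; apply: malg_lin_ext => [c x y|c x y|m].
- by rewrite malgMPl linextP.
- by rewrite linextP malgMPl.
move: v; apply: malg_lin_ext => [c x y|c x y|n].
- by rewrite malgMPr linextP.
- by rewrite linextP malgMPr.
by rewrite malgUM !linextU fmM big_cat.
Qed.

HB.instance Definition _ :=
  GRing.isMonoidMorphism.Build Hdif Hdif2 Delta Delta_is_monoid_morphism.

Lemma Delta_on_gen n : Delta (gen n) = Delta_gen n.
Proof.
case: n => [|n]; first by rewrite rmorph1 Delta_gen0.
by rewrite /Delta linextU fmU big_seq1.
Qed.

Fact counit_is_monoid_morphism : monoid_morphism counit.
Proof. by have [? ?] := mcoeff1g_is_multiplicative {fmonom nat} K. Qed.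

Lemma counit_gen n : counit (gen n.+1) = 0.
Proof. by rewrite /counit mcoeffU fm1_eq1. Qed.

End HopfDif.

(* lambda (n_1, ..., n_k); the index i : 'I_k stands for i + 1, so that       *)
(* m_1 + ... + m_h is the sum of the m_i with i < h.                          *)
Definition lambda (k : nat) (nu : 'I_k -> nat) : nat :=
  (\sum_(m : {ffun 'I_k -> 'I_k.+1} |
         (\sum_i m i == k) &&
         [forall h : 'I_k, (0 < h) ==> (h <= \sum_(i < k | i < h) m i)])
     \prod_(i < k) 'C((nu i).+1, m i))%N.

(* Main.v *)
Require Import Defs.
From HB Require Import structures.
From mathcomp Require Import all_boot all_order all_algebra.
From mathcomp Require Import reals complex monalg zify ring.

Set Implicit Arguments.
Unset Strict Implicit.
Unset Printing Implicit Defensive.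

Import GRing.Theory.
Local Open Scope ring_scope.

(** Pairing the antipode axiom S * id = epsilon with a_n gives, for n >= 1,
        \sum_(m <= n) S(a_m) [x^(n+1)] A(x)^(m+1) = 0,
    a triangular system that determines every S(a_n).  It therefore suffices to
    exhibit one solution.

    Words in the letters a_1, a_2, ... are compositions, and the coefficient of
    x^(k+d) in A(x)^k is the sum over the compositions v of d of
    'C(k, size v) a_v [serexp_Aser]: choose which of the k factors contribute
    something else than x.  Give the word w = (n_1, ..., n_l) the coefficient
    c(w) = (-1)^l lambda(n_1, ..., n_(l-1)).  Cutting words into a prefix and a
    suffix, the system becomes the scalar identity
        \sum_(0 <= i <= l) c(n_1 .. n_i) 'C(n_1 + ... + n_i + 1, l - i) = 0
    for each nonempty word [word_coef_cancel].

    This identity is proved with polynomials in one variable u.  The number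
    lambda(n_1, ..., n_k) counts walks on the natural numbers that start at 0,
    gain m_h at time h (with weight 'C(n_h + 1, m_h)), pay 1, never fall below
    0, and end at 0.  Let each letter n be a series of n + 1 independent trials
    of success probability u, the gain being the number of successes; then run
    the walk until it meets a payment that it cannot make.  Failing exactly at
    the (i+1)-st payment means that the walk is at 0 after i steps and that the
    next letter brings no success: altogether i successes among
    (n_1 + 1) + ... + (n_(i+1) + 1) trials, so the event has probability
        lambda(n_1, ..., n_i) u^i (1 - u)^(n_1 + ... + n_(i+1) + 1),
    and surviving the l payments of the word needs at least l successes, so
    that this probability is divisible by u^l.  Hence
        1 = \sum_(i < l) lambda(n_1, ..., n_i) u^i
                            (1 - u)^(n_1 + ... + n_(i+1) + 1)  (mod u^l),
    which is [ballot_expansion] for a walk starting at 0; its coefficient of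
    u^(l-1) is the scalar identity. *)

(** * Reindexing finite sums *)

Section FiniteSums.

Lemma sum_ord_extend (V : nmodType) (b c : nat) (F : nat -> V) :
  (b <= c)%N -> (forall x, (b <= x)%N -> F x = 0) ->
  \sum_(x < c) F x = \sum_(x < b) F x.
Proof.
move=> le_bc F0; rewrite (big_ord_widen c F le_bc) [RHS]big_mkcond /=.
by apply: eq_bigr => x _; case: ltnP => // /F0.
Qed.

Lemma sum_triangle (V : nmodType) (n : nat) (G : nat -> nat -> V) :
  \sum_(m < n) \sum_(p < m.+1) G p (m - p)%N =
  \sum_(p < n) \sum_(q < n - p) G p q.
Proof.
elim: n => [|n IH]; first by rewrite !big_ord0.
rewrite [LHS]big_ord_recr [RHS]big_ord_recr /= IH big_ord_recr /= addrA.
rewrite subSnn big_ord1 subnn; congr (_ + _); rewrite -big_split /=.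
apply: eq_bigr => p _; rewrite subSn ?big_ord_recr //; exact: ltnW.
Qed.

Definition ffun_cons (T : Type) (k : nat) (x : T) (g : {ffun 'I_k -> T}) :
  {ffun 'I_k.+1 -> T} := [ffun i => oapp g x (unlift ord0 i)].

Lemma ffun_cons0 (T : Type) (k : nat) (x : T) (g : {ffun 'I_k -> T}) :
  ffun_cons x g ord0 = x.
Proof. by rewrite ffunE unlift_none. Qed.

Lemma ffun_consS (T : Type) (k : nat) (x : T) (g : {ffun 'I_k -> T}) i :
  ffun_cons x g (lift ord0 i) = g i.
Proof. by rewrite ffunE liftK. Qed.

Lemma sum_ffun_ordS (V : nmodType) (T : finType) (k : nat)
    (P : pred {ffun 'I_k.+1 -> T}) (F : {ffun 'I_k.+1 -> T} -> V) :
  \sum_(f | P f) F f =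
  \sum_x \sum_(g : {ffun 'I_k -> T} | P (ffun_cons x g)) F (ffun_cons x g).
Proof.
rewrite pair_big_dep /=.
rewrite (reindex (fun p : T * {ffun 'I_k -> T} => ffun_cons p.1 p.2)) //=.
exists (fun f => (f ord0, [ffun i => f (lift ord0 i)])) => [[x g] _|f _] /=.
  by rewrite ffun_cons0; congr pair; apply/ffunP => i; rewrite ffunE ffun_consS.
apply/ffunP => i; case: (unliftP ord0 i) => [j|] ->.
  by rewrite ffun_consS ffunE.
by rewrite ffun_cons0.
Qed.

End FiniteSums.

(** * Ballot walks and the coefficients lambda *)

Section Ballot.

(** The weighted count of the walks that start at d, gain m with weight
    'C(n + 1, m) and then pay 1 for each letter n of s, can make every payment,
    and end at 0.  Recursion on the first letter forces the starting point d
    to be a parameter. *)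
Fixpoint ballot (d : nat) (s : seq nat) : nat :=
  if s is n :: s' then
    (\sum_(m < n.+2 | 0 < d + m) 'C(n.+1, m) * ballot (d + m).-1 s')%N
  else d == 0%N.

Lemma ballot_small d s : (size s < d)%N -> ballot d s = 0%N.
Proof.
elim: s d => [|n s IH] d /=; first by case: d.
move=> lt_sd; apply: big1 => m _; rewrite IH ?muln0 //; lia.
Qed.

(** The gains of a contributing walk are bounded both by the letter and by the
    number of payments left, so either bound may delimit the sum. *)
Lemma ballotE b d n s : (size s < b.-1)%N ->
  ballot d (n :: s) =
  (\sum_(m < b | 0 < d + m) 'C(n.+1, m) * ballot (d + m).-1 s)%N.
Proof.
move=> lt_sb; rewrite /= [LHS]big_mkcond [RHS]big_mkcond /=.
pose F m := if (0 < d + m)%N then ('C(n.+1, m) * ballot (d + m).-1 s)%N else 0%N.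
have F0 m : (minn n.+2 b <= m)%N -> F m = 0%N.
  rewrite /F; case: ifP => // dm0; rewrite geq_min => /orP[h|h].
    by rewrite bin_small.
  by rewrite ballot_small ?muln0 //; lia.
transitivity (\sum_(m < minn n.+2 b) F m)%N.
  by apply: (@sum_ord_extend nat); rewrite ?geq_minl.
by symmetry; apply: (@sum_ord_extend nat); rewrite ?geq_minr.
Qed.

(** Splitting off the first gain x replaces the starting point d by d + x - 1.
    When d + x = 0, the path is excluded by the condition at time 1 or, for a
    single letter, by the value of the total. *)
Lemma sum_ballot_paths (b k d : nat) (nu : 'I_k -> nat) : (k < b)%N ->
  (\sum_(m : {ffun 'I_k -> 'I_b} | (d + \sum_i m i == k) &&
         [forall h : 'I_k, h <= d + \sum_(i < k | i < h) m i])
     \prod_(i < k) 'C((nu i).+1, m i))%N = ballot d [seq nu i | i <- enum 'I_k].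
Proof.
elim: k d nu => [|k IH] d nu lt_kb.
  have -> : [seq nu i | i <- enum 'I_0] = [::].
    by apply: size0nil; rewrite size_map size_enum_ord.
  case: d => [|d] /=; last by apply: big_pred0 => m.
  rewrite (big_pred1 [ffun=> Ordinal lt_kb]) => [|m]; first by rewrite big_ord0.
  have -> : m = [ffun=> Ordinal lt_kb] by apply/ffunP => -[].
  by rewrite big_ord0 /= eqxx; apply/forallP => -[].
rewrite enum_ordSl map_cons -map_comp (@ballotE b); last first.
  by rewrite size_map size_enum_ord; lia.
rewrite (@sum_ffun_ordS nat) [RHS]big_mkcond /=; apply: eq_bigr => x _.
case: ifP => dx.
  rewrite -(IH _ (nu \o lift ord0)) ?big_distrr; last by lia.
  apply: eq_big => [g|g _] /=; last first.
    rewrite big_ord_recl ffun_cons0; congr muln.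
    by apply: eq_bigr => i _; rewrite ffun_consS.
  rewrite big_ord_recl ffun_cons0 (eq_bigr (fun i => val (g i))); last first.
    by move=> i _; rewrite ffun_consS.
  congr andb; first by move: dx (\sum_(i < k) _)%N; clear; lia.
  have prefixS (h : 'I_k) :
    (\sum_(i < k.+1 | i < lift ord0 h) ffun_cons x g i =
     x + \sum_(i < k | i < h) g i)%N.
    rewrite big_mkcond big_ord_recl ffun_cons0 /=; congr addn.
    by rewrite [RHS]big_mkcond; apply: eq_bigr => i _; rewrite ffun_consS.
  apply/forallP/forallP => H h.
    move: (H (lift ord0 h)); rewrite prefixS /= /bump /=; lia.
  case: (unliftP ord0 h) => [j|] -> //; rewrite prefixS /= /bump /=.
  by move: (H j); lia.
apply: big1 => g /andP[Hsum Hprefix]; exfalso; move: Hsum Hprefix.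
clear IH nu; case: k lt_kb g => [|k] lt_kb g.
  by rewrite big_ord1 ffun_cons0; lia.
move=> _ /forallP /(_ (lift ord0 ord0)).
rewrite big_mkcond big_ord_recl ffun_cons0 big1 //= /bump /=; lia.
Qed.

Lemma lambdaE (k : nat) (nu : 'I_k -> nat) :
  lambda nu = ballot 0 [seq nu i | i <- enum 'I_k].
Proof.
rewrite -(@sum_ballot_paths k.+1) // /lambda; apply: eq_bigl => m.
congr andb; apply: eq_forallb => h; rewrite add0n.
by case: (val h).
Qed.

Context (K : comNzRingType).

Lemma coef_1subXn (n q : nat) :
  ((1 - 'X : {poly K}) ^+ n)`_q = (-1) ^+ q * 'C(n, q)%:R.
Proof.
elim: n q => [|n IH] q.
  by rewrite expr0 coef1 bin0n; case: q => [|q]; rewrite ?mulr0 ?mul1r.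
rewrite exprS mulrBl mul1r coefB coefXM; case: q => [|q] /=.
  by rewrite subr0 IH !bin0.
by rewrite !IH binS natrD exprS; ring.
Qed.

Lemma bernstein_sum (n : nat) :
  \sum_(m < n.+1) ('X ^+ m * (1 - 'X) ^+ (n - m)) *+ 'C(n, m) = 1 :> {poly K}.
Proof.
rewrite -[RHS](expr1n _ n) -[X in X ^+ n](subrK 'X) exprDn.
by apply: eq_bigr => m _; rewrite mulrC.
Qed.

(** The generalisation over d and D makes induction on the word possible: d is
    the number of successes in hand and D - d the number of failures so far.
    The next letter n brings n + 1 trials, and the Bernstein identity splits the
    polynomial according to the number m of successes.  The term with
    d + m = 0 is the failure at this payment; every other one has a factor 'X,
    which is the payment, and the rest has the same form with d + m - 1 and
    D + n.  Since each step extracts a factor 'X, the coefficients of index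
    below the length of the word are exact. *)
Lemma ballot_expansion (s : seq nat) (d D q : nat) : (d <= D)%N ->
  (q < size s)%N ->
  ('X^d * (1 - 'X) ^+ (D - d) : {poly K})`_q =
  (\sum_(i < size s) ('X^i * (1 - 'X) ^+ (D + sumn (take i.+1 s)).+1)
     *+ ballot d (take i s))`_q.
Proof.
elim: s d D q => // n s IH d D q le_dD lt_qs.
have -> : ('X^d : {poly K}) = \sum_(m < n.+2)
    'X^d * ('X ^+ m * (1 - 'X) ^+ (n.+1 - m) *+ 'C(n.+1, m)).
  by rewrite -mulr_sumr bernstein_sum mulr1.
rewrite mulr_suml.
rewrite [in RHS]big_ord_recl /= -/(size s) take0 addn0 expr0 mul1r.
(* failed payment, d + m = 0, against the successful ones *)
rewrite (bigID (fun m : 'I_n.+2 => (0 < d + m)%N)) /= addrC !coefD.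
congr (_ + _).
  case: d le_dD => [|d] le_dD; last by rewrite big_pred0 // mulr0n.
  rewrite (big_pred1 ord0) => [|m]; last by rewrite /= add0n lt0n negbK.
  rewrite !expr0 !mul1r subn0 bin0 !mulr1n -exprD.
  by rewrite (_ : n.+1 - ord0 + D = (D + n).+1)%N //= subn0; lia.
pose T i : {poly K} := 'X^i * (1 - 'X) ^+ (D + n + sumn (take i.+1 s)).+1.
transitivity (('X * \sum_(i < size s) T i *+ ballot d (n :: take i s))`_q);
  last first.
  congr (nth 0 (polyseq _) q); rewrite mulr_sumr; apply: eq_bigr => i _.
  by rewrite /T mulrnAr mulrA -exprS addnA.
rewrite coefXM.
have -> : \sum_(m < n.+2 | (0 < d + m)%N)
    'X^d * ('X^m * (1 - 'X) ^+ (n.+1 - m) *+ 'C(n.+1, m)) * (1 - 'X) ^+ (D - d)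
  = 'X * \sum_(m < n.+2 | (0 < d + m)%N)
      ('X ^+ (d + m).-1 * (1 - 'X) ^+ (D + n - (d + m).-1)) *+ 'C(n.+1, m)
    :> {poly K}.
  rewrite mulr_sumr; apply: eq_bigr => m dm0.
  rewrite !(mulrnAr, mulrnAl); congr (_ *+ _).
  have -> : (D + n - (d + m).-1 = n.+1 - m + (D - d))%N.
    by case: m dm0 => m /= lt_m; lia.
  rewrite [RHS]mulrA -exprS prednK // !exprD.
  by rewrite -!mulrA.
rewrite coefXM; case: q lt_qs => //= q; rewrite ltnS => lt_qs.
rewrite !coef_sum.
transitivity (\sum_(m < n.+2 | (0 < d + m)%N)
   (\sum_(i < size s) T i *+ ballot (d + m).-1 (take i s))`_q *+ 'C(n.+1, m)).
  apply: eq_bigr => m dm0; rewrite coefMn; congr (_ *+ _).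
  by apply: IH => //; case: m dm0 => m /= lt_m; lia.
under eq_bigr do rewrite coef_sum -sumrMnl.
rewrite exchange_big /=; apply: eq_bigr => i _.
rewrite coefMn -sumrMnr; apply: eq_bigr => m _.
by rewrite coefMn -mulrnA mulnC.
Qed.

(** The coefficient of the word w in the antipode of the generator of degree
    [sumn w]; the last letter does not enter lambda. *)
Definition word_coef (w : seq nat) : K :=
  (-1) ^+ size w * (ballot 0 (take (size w).-1 w))%:R.

(** This compares the coefficients of index [size w - 1] in [ballot_expansion]
    for d = D = 0: the empty prefix corresponds to the constant 1 on its left,
    the prefix [take i.+1 w] to the i-th term on its right, and both sides are
    multiplied by the sign (-1)^(size w - 1). *)
Lemma word_coef_cancel (w : seq nat) : (0 < size w)%N ->
  \sum_(i < (size w).+1)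
     word_coef (take i w) * 'C((sumn (take i w)).+1, size w - i)%:R = 0.
Proof.
case: w => // n w _; set s := n :: w; rewrite /=.
have /= := @ballot_expansion s 0 0 (size w) (leqnn 0) (ltnSn _).
rewrite mul1r expr0 coef1 coef_sum => E.
rewrite big_ord_recl /= /word_coef /= mul1r subn0 mul1r.
have -> : 'C(1, (size w).+1)%:R = (-1) ^+ size w * (size w == 0%N)%:R :> K.
  by case: (size w) => [|l]; rewrite ?mulr1 // mulr0.
rewrite E mulr_sumr -big_split big1 // => i _ /=.
rewrite coefMn coefXnM ltnNge -ltnS ltn_ord /= coef_1subXn add0n.
have size_ti : size (take i w) = i by apply: size_takel; rewrite -ltnS.
rewrite /= size_ti !add0n subSS.
have -> : take i (n :: take i w) = take i s.
  by rewrite /s; case: (val i) => //= j; rewrite take_takel.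
rewrite -(mulr_natr _ (ballot _ _)) !mul1r; set b := (ballot _ _)%:R.
set c := (binomial _ _)%:R.
have -> : (-1) ^+ size w = (-1) ^+ i * (-1) ^+ (size w - i) :> K.
  by rewrite -exprD subnKC // -ltnS.
(* the signs match up to (-1) ^+ (size w - i) squared *)
rewrite exprS; set u := (-1) ^+ i; set v := (-1) ^+ _.
have vv : v * v = 1 by rewrite -expr2 sqrr_sign.
transitivity (u * b * c * (v * v - 1)); first by ring.
by rewrite vv; ring.
Qed.
End Ballot.

(** * Compositions of an integer *)

Section Compositions.

Fixpoint compositions (k n : nat) : seq (seq nat) :=
  if k is k'.+1 then
    [seq p.+1 :: w | p <- iota 0 n, w <- compositions k' (n - p.+1)]
  else if n is 0 then [:: [::]] else [::].

Context (V : nmodType).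

Lemma sum_compositions0 (n : nat) (F : seq nat -> V) :
  \sum_(w <- compositions 0 n) F w = if n == 0%N then F [::] else 0.
Proof. by case: n => [|n] /=; rewrite ?big_seq1 ?big_nil. Qed.

Lemma sum_compositionsS (k n : nat) (F : seq nat -> V) :
  \sum_(w <- compositions k.+1 n) F w =
  \sum_(p < n) \sum_(w <- compositions k (n - p.+1)) F (p.+1 :: w).
Proof.
rewrite big_allpairs_dep -[n in iota 0 n]subn0 -/(index_iota 0 n).
by rewrite big_mkord.
Qed.

Lemma compositionsP (k n : nat) (w : seq nat) :
  w \in compositions k n -> [/\ size w = k, sumn w = n & all (leq 1) w].
Proof.
elim: k n w => [|k IH] n w /=; first by case: n => // /[!inE] /eqP ->.
case/allpairsPdep => p [v [/[!mem_iota] lt_pn /IH [sz_v sum_v pos_v] ->]] /=.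
by rewrite sz_v sum_v; split=> //; lia.
Qed.

Lemma compositions_small (k n : nat) : (n < k)%N -> compositions k n = [::].
Proof.
move=> lt_nk; case E: compositions => [//|w s].
have /compositionsP[sz_w sum_w pos_w] : w \in compositions k n.
  by rewrite E mem_head.
suff : (size w <= sumn w)%N by lia.
by elim: (w) pos_w => //= x v IHv /andP[? /IHv]; lia.
Qed.

(** Cutting a composition after its i-th part is a bijection onto pairs of
    compositions; this turns a product of two sums over words into one. *)
Lemma sum_compositions_cut (i j n : nat) (F : seq nat -> seq nat -> V) :
  \sum_(w <- compositions (i + j) n) F (take i w) (drop i w) =
  \sum_(m < n.+1) \sum_(u <- compositions i m)
     \sum_(v <- compositions j (n - m)) F u v.
Proof.
elim: i n F => [|i IH] n F.
  rewrite big_ord_recl [X in _ + X]big1 ?addr0 => [|m _]; last first.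
    by rewrite lift0 /= big_nil.
  by rewrite big_seq1 subn0; apply: eq_bigr => w _; rewrite take0 drop0.
rewrite sum_compositionsS.
under eq_bigr do rewrite (IH _ (fun u v => F (_ :: u) v)).
pose G p q := \sum_(u <- compositions i q)
  \sum_(v <- compositions j (n - p.+1 - q)) F (p.+1 :: u) v.
rewrite big_ord_recl sum_compositionsS big_ord0 add0r.
transitivity (\sum_(p < n) \sum_(q < n - p) G p q).
  by apply: eq_bigr => p _; rewrite -subSn ?ltn_ord // subSS.
rewrite -sum_triangle; apply: eq_bigr => m _.
rewrite lift0 sum_compositionsS; apply: eq_bigr => p _.
rewrite subSS; apply: eq_bigr => u _; congr bigop.body.
by congr (compositions j _); case: p => p /=; lia.
Qed.

Lemma sum_compositions_ffun (b k n : nat) (F : seq nat -> V) : (n < b)%N ->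
  \sum_(nu : {ffun 'I_k -> 'I_b} | [forall i, 0 < nu i]%N &&
       (\sum_i nu i == n)%N) F [seq nat_of_ord (nu i) | i <- enum 'I_k] =
  \sum_(w <- compositions k n) F w.
Proof.
elim: k n F => [|k IH] n F lt_nb.
  have enum0 : enum 'I_0 = [::] by apply: size0nil; rewrite size_enum_ord.
  rewrite sum_compositions0 enum0 /= eq_sym; case: ifP => n0.
    rewrite (big_pred1 [ffun=> Ordinal lt_nb]) => [//|nu].
    have -> : nu = [ffun=> Ordinal lt_nb] by apply/ffunP => -[].
    by rewrite big_ord0 n0 andbT /= eqxx; apply/forallP => -[].
  by apply: big_pred0 => nu; rewrite big_ord0 n0 andbF.
rewrite sum_ffun_ordS sum_compositionsS.
pose H p := if p is p'.+1 then
  \sum_(w <- compositions k (n - p)) F (p :: w) else 0.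
transitivity (\sum_(p < b) if (p <= n)%N then H p else 0).
  apply: eq_bigr => p _.
  case: ifP => [le_pn|lt_np]; last first.
    apply: big1 => g /andP[_]; rewrite big_ord_recl ffun_cons0 => /eqP En.
    by exfalso; move: lt_np; rewrite -En leq_addr.
  case Ep: (val p) le_pn => [|p'] le_pn; rewrite /= ?Ep.
    by apply: big1 => g /andP[/forallP/(_ ord0)]; rewrite ffun_cons0 Ep.
  rewrite -(IH _ (fun w => F (p'.+1 :: w))); last by lia.
  apply: eq_big => [g|g _]; last first.
    rewrite enum_ordSl map_cons ffun_cons0 Ep -map_comp.
    by congr (F (_ :: _)); apply: eq_map => i /=; rewrite ffun_consS.
  congr andb.
    apply/forallP/forallP => gP i.
      by move: (gP (lift ord0 i)); rewrite ffun_consS.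
    case: (unliftP ord0 i) => [j|] ->; first by rewrite ffun_consS.
    by rewrite ffun_cons0 Ep.
  rewrite big_ord_recl ffun_cons0 Ep.
  rewrite (eq_bigr (fun i => nat_of_ord (g i))) => [|i _]; last first.
    by rewrite ffun_consS.
  by move: (\sum_(i < k) _)%N => t; move: le_pn; clear; lia.
rewrite (@sum_ord_extend V n.+1 b (fun p => if (p <= n)%N then H p else 0)) //.
  by rewrite big_ord_recl /= add0r; apply: eq_bigr => p _; rewrite ltn_ord.
by move=> x lt_nx; rewrite leqNgt lt_nx.
Qed.

End Compositions.

(** * The antipode on the generators *)

Section Antipode.
Context (K : comNzRingType).
Local Notation gen := (gen K).

Definition word (w : seq nat) : Hdif K := \prod_(i <- w) gen i.

(** In each of the k factors of A(x)^k choose either x or a term a_p x^(p+1)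
    with p > 0; by induction on k this is Pascal's rule. *)
Lemma serexp_Aser (k d : nat) :
  serexp (Aser K) k (k + d) =
  \sum_(j < k.+1) (\sum_(v <- compositions j d) word v) *+ 'C(k, j).
Proof.
pose P j d := \sum_(v <- compositions j d) word v.
have PS j e : P j.+1 e = \sum_(p < e) gen p.+1 * P j (e - p.+1)%N.
  rewrite /P sum_compositionsS; apply: eq_bigr => p _; rewrite mulr_sumr.
  by apply: eq_bigr => w _; rewrite /word big_cons.
elim: k d => [|k IH] d.
  rewrite big_ord1 sum_compositions0 /word big_nil /= /ser1.
  by case: eqP.
rewrite /= {1}/sermul addSn big_ord_recl mul0r add0r.
transitivity (\sum_(p < d.+1) gen p * serexp (Aser K) k (k + (d - p))).
  pose T p := gen p * serexp (Aser K) k (k + d - p).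
  transitivity (\sum_(p < (k + d).+1) T p).
    by apply: eq_bigr => p _; rewrite /T /= /bump /= add1n subSS.
  have -> : \sum_(p < (k + d).+1) T p = \sum_(p < d.+1) T p.
    have [-> //|k_gt0] := posnP k.
    apply: sum_ord_extend => [|p lt_dp]; first by rewrite ltnS leq_addl.
    by rewrite /T serexp_eq0 ?mulr0 //; lia.
  by apply: eq_bigr => p _; rewrite /T addnBA // -ltnS.
rewrite big_ord_recl mul1r subn0 IH.
transitivity (\sum_(j < k.+1) P j d *+ 'C(k, j) +
              \sum_(j < k.+1) P j.+1 d *+ 'C(k, j)).
  congr (_ + _); under [RHS]eq_bigr do rewrite PS -sumrMnl.
  rewrite exchange_big /=; apply: eq_bigr => p _; rewrite IH mulr_sumr.
  by apply: eq_bigr => j _; rewrite mulrnAr.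
rewrite [RHS]big_ord_recl.
under [X in _ = _ + X]eq_bigr do rewrite lift0 binS mulrnDr.
rewrite big_split /= addrA; congr (_ + _).
rewrite [RHS]addrC.
rewrite (@sum_ord_extend _ k k.+1 (fun j => P j.+1 d *+ 'C(k, j.+1))) //.
  by rewrite addrC big_ord_recl !bin0.
by move=> j le_kj; rewrite bin_small ?mulr0n.
Qed.

Definition antipode_gen (n : nat) : Hdif K :=
  \sum_(k < n.+1) \sum_(w <- compositions k n) word_coef K w *: word w.

(** For m <= n, [T m i j] is the part of the m-th product with i letters in the
    left factor and j in the right one.  It vanishes as soon as i or j exceeds
    the number of letters available, so the ranges of i and j may be changed
    freely until the sum is organised by the length k = i + j of the words,
    where [word_coef_cancel] applies to each word. *)
Lemma antipode_gen_inverse (n : nat) : (0 < n)%N ->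
  \sum_(m < n.+1) antipode_gen m * serexp (Aser K) m.+1 n.+1 = 0.
Proof.
move=> n_gt0.
pose T m i j := \sum_(u <- compositions i m) \sum_(v <- compositions j (n - m))
  (word_coef K u * 'C((sumn u).+1, j)%:R) *: word (u ++ v).
have T_small m i j : (m < i)%N -> T m i j = 0.
  by move=> lt_mi; rewrite /T compositions_small ?big_nil.
have T_short m i j : (n - m < j)%N -> T m i j = 0.
  by move=> lt_j; rewrite /T big1 // => u _; rewrite compositions_small ?big_nil.
have T_bin m i j : (m.+1 < j)%N -> T m i j = 0.
  move=> lt_mj; rewrite /T big_seq big1 // => u /compositionsP[_ -> _].
  by rewrite big1 // => v _; rewrite bin_small // mulr0 scale0r.
transitivity (\sum_(m < n.+1) \sum_(i < n.+1) \sum_(j < n.+1 - i) T m i j).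
  apply: eq_bigr => m _; have le_mn : (m <= n)%N by rewrite -ltnS.
  have En : n.+1 = (m.+1 + (n - m))%N by rewrite addSn subnKC.
  rewrite [X in serexp _ _ X]En serexp_Aser /antipode_gen mulr_suml.
  rewrite [RHS](@sum_ord_extend _ m.+1 n.+1
                  (fun i => \sum_(j < n.+1 - i) T m i j)) //; last first.
    by move=> i lt_mi; rewrite big1 // => j _; apply: T_small.
  apply: eq_bigr => i _; have le_im : (i <= m)%N by rewrite -ltnS.
  transitivity (\sum_(j < m.+2) T m i j).
    rewrite mulr_sumr; apply: eq_bigr => j _.
    rewrite mulr_suml /T; apply: eq_big_seq => u /compositionsP[_ -> _].
    rewrite -scalerAl (mulrnAr (word u)) mulr_sumr.
    rewrite -scaler_nat scalerA scaler_sumr.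
    by apply: eq_bigr => v _; rewrite /word big_cat.
  rewrite -(@sum_ord_extend _ m.+2 (m.+2 + n.+1) (T m i)) ?leq_addr //;
    last by move=> j; apply: T_bin.
  by apply: sum_ord_extend => [|j le_j]; rewrite ?T_short //; lia.
rewrite exchange_big /=; under eq_bigr do rewrite exchange_big /=.
rewrite -(sum_triangle _ (fun i j => \sum_(m < n.+1) T m i j)).
apply: big1 => k _.
transitivity (\sum_(i < k.+1) \sum_(w <- compositions k n)
    (word_coef K (take i w) * 'C((sumn (take i w)).+1, k - i)%:R) *: word w).
  apply: eq_bigr => i _.
  rewrite -(sum_compositions_cut _ _ _ (fun u v =>
    (word_coef K u * 'C((sumn u).+1, k - i)%:R) *: word (u ++ v))).
  rewrite subnKC -1?ltnS //.
  by apply: eq_bigr => w _; rewrite cat_take_drop.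
rewrite exchange_big big_seq big1 // => w /compositionsP[sz_w sum_w _] /=.
rewrite -scaler_suml -sz_w word_coef_cancel ?scale0r //.
by case: (w) sum_w n_gt0 => //= <-.
Qed.

(** The left antipode axiom at the generator of degree n. *)
Lemma antipode_recurrence (S : {linear Hdif K -> Hdif K}) (n : nat) :
  is_antipode S ->
  \sum_(m < n.+1) S (gen m) * serexp (Aser K) m.+1 n.+1 = (n == 0%N)%:R.
Proof.
case=> /(_ (gen n)) + _; rewrite Delta_on_gen Delta_genE.
rewrite /tmap linear_sum /tmul linear_sum /=.
under eq_bigr do rewrite -/(tmap S idfun _) tmap_tens -/(tmul _) tmul_tens.
move=> ->; case: n => [|n]; last by rewrite counit_gen scale0r.
by rewrite (fst (counit_is_monoid_morphism K) : counit (gen 0) = 1) scale1r.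
Qed.

Lemma serexp_Aser_diag (k : nat) : serexp (Aser K) k k = 1.
Proof.
rewrite -[X in serexp _ _ X]addn0 serexp_Aser big_ord_recl bin0 big_seq1.
by rewrite big1 ?addr0 => [|j _]; rewrite /word ?big_nil // mul0rn.
Qed.

(** Both sides solve the same triangular system, whose diagonal entries are 1 by
    [serexp_Aser_diag]. *)
Lemma antipode_genE (S : {linear Hdif K -> Hdif K}) (n : nat) :
  is_antipode S -> S (gen n) = antipode_gen n.
Proof.
move=> hS; elim/ltn_ind: n => n IH.
have := antipode_recurrence n hS.
have : \sum_(m < n.+1) antipode_gen m * serexp (Aser K) m.+1 n.+1 = (n == 0%N)%:R.
  case: n {IH} => [|n]; last exact: antipode_gen_inverse.
  rewrite big_ord1 serexp_Aser_diag mulr1 /antipode_gen big_ord1 big_seq1.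
  by rewrite /word big_nil /word_coef /= expr0 mul1r scale1r.
rewrite !big_ord_recr (serexp_Aser_diag _ : serexp _ (@ord_max n).+1 n.+1 = 1).
rewrite !mulr1 => <-.
rewrite (eq_bigr (fun m : 'I_n => antipode_gen m * serexp (Aser K) m.+1 n.+1)).
  by move/addrI.
by move=> m _; rewrite (IH m (ltn_ord m)).
Qed.

(** Words of length k + 1 come with the sign (-1)^(k+1), whence the overall
    minus sign; the words of length 1 give the isolated term - a_n. *)
Lemma antipode_gen_lambda (n : nat) : (1 <= n)%N ->
  antipode_gen n = - gen n
    - \sum_(1 <= k < n) (-1) ^+ k *
        \sum_(nu : {ffun 'I_k.+1 -> 'I_n.+1} |
               [forall i, 0 < nu i]%N && (\sum_i nu i == n)%N)
          (\prod_(i < k.+1) gen (nu i)) *+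
            lambda (fun i : 'I_k => nat_of_ord (nu (widen_ord (leqnSn k) i))).
Proof.
move=> n_gt0.
pose T k := \sum_(w <- compositions k.+1 n) word w *+ ballot 0 (take k w).
have T0 : T 0%N = gen n.
  rewrite /T sum_compositionsS; case: n n_gt0 {T} => // n _.
  rewrite big_ord_recr big1 => [|p _]; last first.
    by rewrite sum_compositions0 /= subSS subn_eq0 leqNgt ltn_ord.
  by rewrite subnn sum_compositions0 /word big_seq1 mulr1n Monoid.mul1m.
have TE k : \sum_(w <- compositions k.+1 n) word_coef K w *: word w =
    - ((-1) ^+ k * T k).
  rewrite /T mulr_sumr -sumrN; apply: eq_big_seq => w /compositionsP[sz_w _ _].
  rewrite /word_coef sz_w exprS -!scalerA scaler_nat /=.
  rewrite scaleN1r -signr_odd scaler_sign; congr (- _).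
  by rewrite -signr_odd mulr_sign.
rewrite /antipode_gen big_ord_recl sum_compositions0 eqn0Ngt n_gt0 add0r.
under eq_bigr do rewrite lift0 TE.
rewrite -(big_mkord xpredT (fun k => - ((-1) ^+ k * T k))) big_ltn // expr0 mul1r.
rewrite T0 sumrN; congr (_ - _); apply: eq_bigr => k _; congr (_ * _).
rewrite /T -(sum_compositions_ffun (b := n.+1)) //.
apply: eq_bigr => nu _; congr (_ *+ _).
  by rewrite /word big_map enumT [index_enum _]unlock.
rewrite lambdaE; congr ballot.
rewrite enum_ordSr map_rcons -map_comp -cats1 take_size_cat //.
by rewrite size_map size_enum_ord.
Qed.

End Antipode.

Theorem theorem2p14 (R : realType) (S : {linear Hdif R[i] -> Hdif R[i]})
    (hS : is_antipode S) (n : nat) (hn : (1 <= n)%N) :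
  S (gen R[i] n) =
    - gen R[i] n
    - \sum_(1 <= k < n) (-1) ^+ k *
        \sum_(nu : {ffun 'I_k.+1 -> 'I_n.+1} |
               [forall i, 0 < nu i]%N && (\sum_i nu i == n)%N)
          (\prod_(i < k.+1) gen R[i] (nu i)) *+
            lambda (fun i : 'I_k => nat_of_ord (nu (widen_ord (leqnSn k) i))).
Proof. by rewrite (antipode_genE _ hS) antipode_gen_lambda. Qed.
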